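(* Let $H_n$ be random criterion functions on $\mathbb{R}^{d_1}\times\mathbb{R}^{d_2}$ and let $(s_n,t_n)$ be random vectors in $\mathbb{R}^{d_1}\times\mathbb{R}^{d_2}$. Suppose that the following conditions are satisfied: (i) $H_n(s,t)=\alpha_n f_n(s)+\beta_n g_n(s,t)$, where $f_n$ and $g_n$ are random functions on $\mathbb{R}^{d_1}$ and $\mathbb{R}^{d_1}\times\mathbb{R}^{d_2}$ respectively, while $\alpha_n$ and $\beta_n$ are positive (deterministic) numbers with $\beta_n=o(\alpha_n)$; (ii) $(f_n,g_n)\rightsquigarrow(f,g)$ and the limit process $(f,g)$ has continuous sample paths; (iii) $H_n(s_n,t_n)\le\inf_{s,t}H_n(s,t)+o_p^*(\beta_n)$; and (iv) $\|(s_n,t_n)\|=O_p^*(1)$. Assume that the sample paths of $f(\cdot)$ possess a unique minimum at a (random) point $s^*$ and the sample paths of $g(s^*,\cdot)$ possess a unique minimum at $t^*$. Then $(s_n,t_n)\rightsquigarrow(s^*,t^* )$.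
   Context: Convergence in distribution ''$\rightsquigarrow$'' is understood in the sense of Hoffmann–Jørgensen: maps $X_n$ (not necessarily measurable) from probability spaces into a metric space converge in distribution to a Borel measurable random element $X$ if $\mathbb{P}^*h(X_n)\to\mathbb{P}h(X)$ for every bounded continuous real function $h$, where $\mathbb{P}^*$ denotes outer expectation (outer probability for sets). Accordingly, the random functions $f_n,g_n,H_n$ and random vectors $(s_n,t_n)$ may be nonmeasurable. $\mathcal{B}_{\mathrm{loc}}(\mathbb{R}^d)$ denotes the space of all locally bounded real functions on $\mathbb{R}^d$, equipped with the metric $$\rho(g,h)=\sum_{k=1}^\infty 2^{-k}\min[1,\rho_k(g,h)],\qquad \rho_k(g,h)=\sup_{\|t\|\le k}|g(t)-h(t)|,$$ which metrizes uniform convergence on compacta. The random functions $f_n,f$ take values in $\mathcal{B}_{\mathrm{loc}}(\mathbb{R}^{d_1})$ and $g_n,g$ take values in $\mathcal{B}_{\mathrm{loc}}(\mathbb{R}^{d_1}\times\mathbb{R}^{d_2})$; the convergence in (ii) is joint convergence in the product of these metric spaces. $Y_n=O_p^*(1)$ means that for every $\varepsilon>0$ there is $M<\infty$ with $\limsup_n\mathbb{P}^*\{|Y_n|>M\}\le\varepsilon$; $Y_n=o_p^*(\beta_n)$ means $\mathbb{P}^*\{|Y_n|>\varepsilon\beta_n\}\to0$ for every $\varepsilon>0$. The sample path properties required of the limit process (continuity, unique minima) need to hold only almost surely. *)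

(* Defs.v *)
From HB Require Import structures.
From mathcomp Require Import all_boot all_order all_algebra.
From mathcomp Require Import all_classical all_reals all_analysis.
From mathcomp Require Import ring lra.

Set Implicit Arguments.
Unset Strict Implicit.
Unset Printing Implicit Defensive.

Import Order.TTheory GRing.Theory Num.Theory.
Import numFieldNormedType.Exports.

Local Open Scope classical_set_scope.
Local Open Scope ring_scope.

Section outer.
Local Open Scope ereal_scope.
Context d (T : measurableType d) (R : realType) (P : probability T R).

Definition outer_expectation (Y : T -> R) : \bar R :=
  ereal_inf [set \int[P]_w U w | U in
    [set U : T -> \bar R |
      P.-integrable setT U /\ forall w, (Y w)%:E <= U w]].

Definition outer_probability (A : set T) : \bar R :=
  ereal_inf [set P B | B in [set B | measurable B /\ A `<=` B]].

End outer.

Section asymptotics.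
Context (R : realType) (d : nat -> measure_display)
  (T_ : forall n, measurableType (d n)) (P_ : forall n, probability (T_ n) R).

(* Hoffmann-Jorgensen convergence in distribution X_n ~> X; the X_n are
   arbitrary maps.  As a limit process is pinned down only up to a null set, X
   is required to have a Borel measurable version Z rather than to be Borel
   itself; if X is Borel, take Z := X. *)
Definition cvg_in_distribution d0 (T : measurableType d0) (P : probability T R)
    (S : topologicalType) (X_ : forall n, T_ n -> S) (X : T -> S) : Prop :=
  exists Z : T -> S,
    [/\ forall U, open U -> measurable (Z @^-1` U),
        {ae P, forall w, Z w = X w} &
        forall h : S -> R, continuous h -> [bounded h x | x in setT] ->
          outer_expectation (P_ n) (h \o X_ n) @[n --> \oo] --> 'E_P[h \o Z]%E].

Local Open Scope ereal_scope.

Definition bigO_pstar (Y_ : forall n, T_ n -> \bar R) : Prop :=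
  forall eps : R, (0 < eps)%R -> exists M : R,
    limn_esup (fun n => outer_probability (P_ n) [set w | M%:E < `|Y_ n w|])
      <= eps%:E.

Definition littleo_pstar (Y_ : forall n, T_ n -> \bar R) (b : nat -> R) : Prop :=
  forall eps : R, (0 < eps)%R ->
    outer_probability (P_ n) [set w | (eps * b n)%:E < `|Y_ n w|]
      @[n --> \oo] --> 0.

End asymptotics.

Section Bloc.
Context (R : realType) (V : normedModType R).

Record Bloc := MkBloc {
  Bloc_fun :> V -> R;
  Bloc_bounded : [locally [bounded Bloc_fun x | x in setT]] }.

Lemma BlocP (g h : Bloc) : (forall t, g t = h t) -> g = h.
Proof.
case: g h => [g bg] [h bh] /= gh; have {}gh : g = h by apply/funext.
by rewrite gh in bg *; congr MkBloc; exact: Prop_irrelevance.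
Qed.

Local Open Scope ereal_scope.

(* The supremum is taken in [0, +oo], so that this is well defined on any normed
   space; on a finite-dimensional one it is finite.  The norms of 'rV[R]_d and of
   products are the max norms; another norm gives the same topology on Bloc. *)
Definition rho_ (k : nat) (g h : V -> R) : \bar R :=
  ereal_sup [set `|g t - h t|%:E | t in [set t : V | (`|t| <= k%:R)%R]].

Definition rho (g h : V -> R) : R :=
  fine (\sum_(1 <= k <oo) (2^-1 ^+ k)%:E * mine 1 (rho_ k g h)).

Let term (k : nat) (g h : V -> R) : \bar R :=
  (2^-1 ^+ k)%:E * mine 1 (rho_ k g h).

Let rho_ge0 k (g h : V -> R) : 0 <= rho_ k g h.
Proof.
apply: (@le_trans _ _ `|g 0%R - h 0%R|%:E); first by rewrite lee_fin.
by apply: ereal_sup_ubound; exists 0%R => //=; rewrite normr0.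
Qed.

Let term_ge0 k g h : 0 <= term k g h.
Proof.
by rewrite mule_ge0 ?lee_fin ?exprn_ge0// le_min rho_ge0 lee01.
Qed.

Let term_le k g h : term k g h <= (2^-1 ^+ k)%:E.
Proof. by rewrite -[leRHS]mule1 lee_pmul2l ?lte_fin ?exprn_gt0// ge_min lexx. Qed.

Let total (g h : V -> R) : \bar R := \sum_(1 <= k <oo) term k g h.

Let total_ge0 g h : 0 <= total g h.
Proof. by apply: nneseries_ge0 => n _ _; exact: term_ge0. Qed.

Let total_le1 g h : total g h <= 1.
Proof.
apply: lime_le; first by apply: is_cvg_nneseries => n _ _; exact: term_ge0.
apply: nearW => n; apply: (@le_trans _ _ (\sum_(1 <= k < n) (2^-1 ^+ k)%:E)).
  by apply: lee_sum => k _; exact: term_le.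
rewrite sumEFin lee_fin; case: n => [|n]; first by rewrite big_geq.
suff -> : (\sum_(1 <= k < n.+1) 2^-1 ^+ k = 1 - 2^-1 ^+ n :> R)%R.
  by rewrite gerBl exprn_ge0.
elim: n => [|n ih]; first by rewrite big_geq// expr0 subrr.
by rewrite big_nat_recr//= ih exprS; lra.
Qed.

Let total_fin g h : total g h \is a fin_num.
Proof.
by rewrite ge0_fin_numE// (le_lt_trans (total_le1 g h))// ltry.
Qed.

Let rhoE g h : (rho g h)%:E = total g h.
Proof. by rewrite fineK; last exact: total_fin. Qed.

Let rho_xx k (g : V -> R) : rho_ k g g = 0.
Proof.
apply/eqP; rewrite eq_le rho_ge0 andbT; apply: ge_ereal_sup => _ [t _ <-].
by rewrite subrr normr0.
Qed.

Let rho_C k (g h : V -> R) : rho_ k g h = rho_ k h g.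
Proof. by congr ereal_sup; apply: eq_imagel => t _; rewrite distrC. Qed.

Let rho_triangle k (f g h : V -> R) : rho_ k g h <= rho_ k g f + rho_ k f h.
Proof.
apply: ge_ereal_sup => _ [t tk <-].
apply: (@le_trans _ _ (`|g t - f t|%:E + `|f t - h t|%:E)).
  by rewrite -EFinD lee_fin ler_distD.
by apply: leeD; apply: ereal_sup_ubound; exists t.
Qed.

Let term_triangle k (f g h : V -> R) :
  term k g h <= term k g f + term k f h.
Proof.
rewrite /term -ge0_muleDr ?le_min ?rho_ge0 ?lee01//.
apply: lee_pmul => //; rewrite ?lee_fin ?exprn_ge0 ?le_min ?rho_ge0 ?lee01//.
have [a1|a1] := leP 1 (rho_ k g f).
  by rewrite (@le_trans _ _ 1) ?ge_min ?lexx// leeDl// le_min rho_ge0 lee01.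
have [b1|b1] := leP 1 (rho_ k f h).
  by rewrite (@le_trans _ _ 1) ?ge_min ?lexx// leeDr.
by rewrite ge_min rho_triangle orbT.
Qed.

Let mdistxx (g : Bloc) : rho g g = 0%R.
Proof.
apply: EFin_inj; rewrite rhoE; apply: eseries0 => k _ _.
by rewrite /term rho_xx min_r ?lee01// mule0.
Qed.

Let mdist_positivity (g h : Bloc) : rho g h = 0%R -> g = h.
Proof.
move=> gh0; apply: BlocP => t.
pose k := (Num.truncn `|t|).+1.
have tk : (`|t| <= k%:R)%R by rewrite ltW// truncnS_gt.
have : term k g h <= 0.
  rewrite -[leRHS]/((0%R : R)%:E) -gh0 rhoE.
  apply: le_trans (nneseries_lim_ge k.+1 _) => //.
  by rewrite big_nat_recr//= leeDr// sume_ge0.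
rewrite /term pmule_rle0 ?lte_fin ?exprn_gt0// ge_min lee_fin ler10/= => r0.
have : `|g t - h t|%:E <= rho_ k g h by apply: ereal_sup_ubound; exists t.
move/le_trans => /(_ _ r0); rewrite lee_fin normr_le0 subr_eq0.
by move/eqP.
Qed.

Let mdist_sym (g h : Bloc) : rho g h = rho h g.
Proof.
apply: EFin_inj; rewrite !rhoE; apply: eq_eseriesr => k _.
by rewrite /term rho_C.
Qed.

Let mdist_triangle (f g h : Bloc) : (rho g h <= rho g f + rho f h)%R.
Proof.
rewrite -lee_fin EFinD !rhoE /total -nneseriesD//.
by apply: lee_nneseries => // k _; exact: term_triangle.
Qed.

HB.instance Definition _ := gen_eqMixin Bloc.
HB.instance Definition _ := gen_choiceMixin Bloc.
HB.instance Definition _ :=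
  isMetric.Build R Bloc mdistxx mdist_positivity mdist_sym mdist_triangle.

End Bloc.

Definition unique_min_at (T : Type) (R : realType) (F : T -> R) (x : T) : Prop :=
  (forall y, F x <= F y) /\ (forall y, (forall z, F y <= F z) -> y = x).

(* Main.v *)
Require Import Defs.
From mathcomp Require Import all_boot all_order all_algebra.
From mathcomp Require Import all_classical all_reals all_analysis.
From mathcomp Require Import measurable_realfun ring lra.

(* Dividing the near-minimality of [(s_n, t_n)] by [alpha_n] shows that [s_n]
   nearly minimizes [f_n]; taking [s = s_n] and dividing by [beta_n] shows that
   [t_n] nearly minimizes [g_n (s_n, .)].  If [z_m -> (f, g)] in the product of
   the spaces [Bloc] and [x_m] is a bounded sequence of approximate minimizers
   of [z_m] in this sense, every cluster point of [x_m] is [(sstar, tstar)].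

   No almost sure representation is used.  For bounded continuous [h] and fixed
   [m, M], let [env_m (z)] be the [(m+1)]-Lipschitz regularization of the
   supremum of [h] over the level-[m] approximate minimizers of [z] in the ball
   of radius [M].  It is bounded and continuous, and [h (s_n, t_n)] is at most
   [env_m (f_n, g_n)] outside a set of small outer probability, so hypothesis
   (ii) bounds the limsup of the outer expectations by [E env_m (f, g)].  By the
   cluster property [limsup_m env_m (f, g) <= h (sstar, tstar)], and dominated
   convergence gives the upper bound; the lower bound is the upper bound
   for [-h].  The same neighbourhoods of sets of approximate minimizers express
   the events [(sstar, tstar) \in F], [F] closed, by open events of [(f, g)], whence
   a Borel version of [(sstar, tstar)]. *)

Set Implicit Arguments.
Unset Strict Implicit.
Unset Printing Implicit Defensive.

Import Order.TTheory GRing.Theory Num.Theory.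
Import numFieldNormedType.Exports.

Local Open Scope classical_set_scope.
Local Open Scope ring_scope.

(** * Lipschitz envelopes on a product of two metric spaces *)

Section lipschitz_envelope.
Context (R : realType) (S1 S2 : metricType R).
Local Notation S := (S1 * S2)%type.

Definition sum_dist (z a : S) : R := mdist z.1 a.1 + mdist z.2 a.2.

Lemma sum_dist_ge0 z a : 0 <= sum_dist z a.
Proof. by rewrite addr_ge0// mdist_ge0. Qed.

Lemma sum_distxx z : sum_dist z z = 0.
Proof. by rewrite /sum_dist !mdistxx addr0. Qed.

Lemma sum_distC z a : sum_dist z a = sum_dist a z.
Proof. by rewrite /sum_dist !(metric_sym z.1, metric_sym z.2). Qed.

Lemma sum_dist_triangle y x z : sum_dist x z <= sum_dist x y + sum_dist y z.
Proof. by rewrite /sum_dist addrACA lerD// metric_triangle. Qed.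

(** Exchanging [z] and [z'] turns the one-sided bound into a two-sided one; [|L| + 1] in the modulus
    is positive for every real [L]. *)
Lemma lipschitz_continuous_sum_dist (h : S -> R) (L : R) :
  (forall z z', h z - h z' <= L * sum_dist z z') -> continuous h.
Proof.
move=> hL z; apply/cvgrPdist_le => e e0.
pose r := e / 2 / (`|L| + 1).
have r0 : 0 < r by rewrite !divr_gt0// ltr_pwDr.
have n1 : \forall z' \near z, ball z.1 r z'.1.
  by apply: (@cvg_fst _ _ (nbhs z.1) (nbhs z.2)); exact: nbhsx_ballx.
have n2 : \forall z' \near z, ball z.2 r z'.2.
  by apply: (@cvg_snd _ _ (nbhs z.1) (nbhs z.2)); exact: nbhsx_ballx.
apply: filterS2 n1 n2 => z'; rewrite !ballEmdist/= => z1 z2.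
have zz' : `|L| * sum_dist z z' <= e.
  have -> : e = (`|L| + 1) * (r + r).
    by rewrite /r; field; rewrite gt_eqF// ltr_pwDr.
  by rewrite ler_pM ?sum_dist_ge0// ?lerDl// ltW// ltrD.
have Lzz' : L * sum_dist z z' <= `|L| * sum_dist z z'.
  by rewrite ler_wpM2r ?sum_dist_ge0// ler_norm.
rewrite ler_norml; apply/andP; split; last first.
  by rewrite (le_trans (hL z z'))// (le_trans Lzz').
by rewrite lerNl opprB (le_trans (hL z' z))// sum_distC (le_trans Lzz').
Qed.

(* The smallest [m]-Lipschitz function that is at least [- c] everywhere and at
   least [p.1] at [p.2] for every [p] in [A]. *)
Definition lip_env (m c : R) (A : set (R * S)) (z : S) : R :=
  sup ([set - c] `|` [set p.1 - m * sum_dist z p.2 | p in A]).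

Variables (m c : R) (A : set (R * S)).
Hypotheses (m0 : 0 <= m) (c0 : 0 <= c) (Ac : forall p, A p -> p.1 <= c).

Let values z := [set - c] `|` [set p.1 - m * sum_dist z p.2 | p in A].

Let values_le z : ubound (values z) c.
Proof.
move=> _ [->|[p Ap <-]]; first by rewrite (le_trans _ c0)// oppr_le0.
by rewrite lerBlDr (le_trans (Ac Ap))// lerDl mulr_ge0// sum_dist_ge0.
Qed.

Let values_sup z : has_sup (values z).
Proof. by split; [exists (- c); left|exists c; exact: values_le]. Qed.

Lemma lip_env_ge z : - c <= lip_env m c A z.
Proof. by apply: ub_le_sup; [exists c; exact: values_le|left]. Qed.

Lemma lip_env_le z : lip_env m c A z <= c.
Proof. by apply: ge_sup; [exists (- c); left|exact: values_le]. Qed.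

Lemma lip_env_ub z p : A p -> p.1 - m * sum_dist z p.2 <= lip_env m c A z.
Proof.
by move=> Ap; apply: ub_le_sup; [exists c; exact: values_le|right; exists p].
Qed.

(** Above the floor [- c], a value of the envelope can only come from a pair in [A]. This extracts
    approximate minimizers from a large envelope. *)
Lemma lip_env_gt z r : - c <= r -> r < lip_env m c A z ->
  exists2 p, A p & r < p.1 - m * sum_dist z p.2.
Proof.
move=> cr /(sup_gt (values_sup z).1)[_ [->|[p Ap <-] rp]].
  by rewrite ltNge cr.
by exists p.
Qed.

Lemma lip_env_continuous : continuous (lip_env m c A).
Proof.
apply: (@lipschitz_continuous_sum_dist _ m) => z z'.
rewrite lerBlDr; apply: ge_sup; first by exists (- c); left.
move=> _ [->|[p Ap <-]].
  by rewrite (le_trans (lip_env_ge z'))// lerDr mulr_ge0// sum_dist_ge0.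
apply: (@le_trans _ _ (m * sum_dist z z' + (p.1 - m * sum_dist z' p.2))).
  have : m * sum_dist z' p.2 <= m * (sum_dist z' z + sum_dist z p.2).
    by rewrite ler_wpM2l// sum_dist_triangle.
  by rewrite (sum_distC z' z) mulrDr; lra.
by rewrite lerD2l lip_env_ub.
Qed.

End lipschitz_envelope.

(** * Outer expectation and outer probability *)

Section outer.
Local Open Scope ereal_scope.
Context d (T : measurableType d) (R : realType) (P : probability T R).

Lemma outer_expectation_bounded (Y : T -> R) (k : R) :
  (forall w, (`|Y w| <= k)%R) -> - k%:E <= outer_expectation P Y <= k%:E.
Proof.
move=> Yk; apply/andP; split.
  apply: le_ereal_inf_tmp => _ [U [iU YU] <-].
  have -> : - k%:E = \int[P]_w (cst (- k%:E) w).
    by rewrite integral_cst//= probability_setT mule1.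
  apply: le_integral => //.
    exact: finite_measure_integrable_cst.
  move=> w _; apply: le_trans (YU w); rewrite -EFinN lee_fin.
  by have := Yk w; rewrite ler_norml => /andP[].
apply: ereal_inf_lbound; exists (cst k%:E); last first.
  by rewrite integral_cst//= probability_setT mule1.
split; first exact: finite_measure_integrable_cst.
by move=> w; rewrite lee_fin; have := Yk w; rewrite ler_norml => /andP[].
Qed.

Lemma outer_expectation_fin_num (Y : T -> R) (k : R) :
  (forall w, (`|Y w| <= k)%R) -> outer_expectation P Y \is a fin_num.
Proof.
move=> /outer_expectation_bounded/andP[kY Yk]; apply/fin_real/andP; split.
  by apply: lt_le_trans kY; rewrite -EFinN ltNyr.
by apply: le_lt_trans Yk _; rewrite ltry.
Qed.

(** Integrable majorants of [Y] and of [- Y] have a nonnegative sum. Outer expectation is not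
    linear; this inequality is what turns upper bounds for [- h] into lower bounds for [h]. *)
Lemma outer_expectation_opp_le (Y : T -> R) (k : R) :
  (forall w, (`|Y w| <= k)%R) ->
  - outer_expectation P (\- Y)%R <= outer_expectation P Y.
Proof.
move=> Yk; have Nk w : (`|(\- Y)%R w| <= k)%R by rewrite normrN.
have fN := outer_expectation_fin_num Nk.
apply: le_ereal_inf_tmp => _ [U [iU YU] <-].
have iUfin : \int[P]_w U w \is a fin_num by exact: integrable_fin_num.
rewrite leeNl; apply: le_ereal_inf_tmp => _ [U' [iU' YU'] <-].
have iU'fin : \int[P]_w U' w \is a fin_num by exact: integrable_fin_num.
have : 0 <= \int[P]_w U w + \int[P]_w U' w.
  rewrite -integralD//; apply: integral_ge0 => w _.
  apply: (@le_trans _ _ ((Y w)%:E + ((\- Y)%R w)%:E)).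
    by rewrite -EFinD/= subrr.
  by apply: leeD; [exact: YU|exact: YU'].
by rewrite -(fineK iUfin) -(fineK iU'fin) -EFinD -EFinN !lee_fin; lra.
Qed.

Lemma outer_probability_ge0 (A : set T) : 0 <= outer_probability P A.
Proof. by apply: le_ereal_inf_tmp => _ [B [mB _] <-]. Qed.

Lemma outer_probability_fin_num (A : set T) : outer_probability P A \is a fin_num.
Proof.
rewrite ge0_fin_numE ?outer_probability_ge0//.
apply: (@le_lt_trans _ _ 1); last exact: ltry.
by apply: ereal_inf_lbound; exists setT; rewrite ?probability_setT.
Qed.

Lemma le_outer_probability (A B : set T) :
  A `<=` B -> outer_probability P A <= outer_probability P B.
Proof.
move=> AB; apply: le_ereal_inf => _ [C [mC BC] <-].
by exists C => //; split => //; exact: subset_trans BC.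
Qed.

Lemma outer_probabilityU (A B : set T) :
  outer_probability P (A `|` B) <= outer_probability P A + outer_probability P B.
Proof.
apply/lee_addgt0Pr => e e0; have e20 : (0 < e / 2)%R by exact: divr_gt0.
have [_ [A' [mA' AA'] <-] ltA] :=
  lb_ereal_inf_adherent e20 (outer_probability_fin_num A).
have [_ [B' [mB' BB'] <-] ltB] :=
  lb_ereal_inf_adherent e20 (outer_probability_fin_num B).
apply: (@le_trans _ _ (P (A' `|` B'))).
  apply: ereal_inf_lbound; exists (A' `|` B') => //.
  by split; [exact: measurableU|exact: setUSS].
apply: (@le_trans _ _ (P A' + P B')); first exact: measureU2.
rewrite [e]splitr EFinD addeACA; apply: leeD; exact: ltW.
Qed.

(** If [U] majorizes [Y'] and the measurable set [B] covers [A], then [U] plus [c] times the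
    indicator of [B] majorizes [Y]; take [U] and [B] nearly optimal. *)
Lemma outer_expectation_le_add (A : set T) (Y Y' : T -> R) (c k : R) :
  (0 <= c)%R -> (forall w, `|Y' w| <= k)%R ->
  (forall w, Y w <= Y' w + c)%R -> (forall w, ~ A w -> Y w <= Y' w)%R ->
  outer_expectation P Y <= outer_expectation P Y' + c%:E * outer_probability P A.
Proof.
move=> c0 Y'k Yc YY'.
apply/lee_addgt0Pr => e e0.
have e10 : (0 < e / 2)%R by exact: divr_gt0.
(* This margin gets multiplied by [c]; dividing by [c + 1] keeps the product below [e / 2], also
   when [c = 0]. *)
have e20 : (0 < e / 2 / (c + 1))%R by rewrite divr_gt0// ltr_pwDr.
have [_ [U [iU YU] <-] ltU] :=
  lb_ereal_inf_adherent e10 (outer_expectation_fin_num Y'k).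
have [_ [B [mB AB] <-] ltB] :=
  lb_ereal_inf_adherent e20 (outer_probability_fin_num A).
have i1 : P.-integrable setT (fun w => c%:E * (\1_B w)%:E).
  by apply: integrableZl => //; exact: integrable_indic.
apply: (@le_trans _ _ (\int[P]_w (U w + c%:E * (\1_B w)%:E))).
  apply: ereal_inf_lbound; exists (fun w => U w + c%:E * (\1_B w)%:E) => //.
  split; first exact: integrableD.
  move=> w; have [Aw|nAw] := pselect (A w).
    rewrite indicE mem_set/=; last exact: AB.
    by rewrite mule1 (le_trans _ (leeD (YU w) (lexx _)))// -EFinD lee_fin.
  apply: (@le_trans _ _ (Y' w)%:E); first by rewrite lee_fin YY'.
  by apply: (le_trans (YU w)); rewrite leeDl// -EFinM lee_fin mulr_ge0.
rewrite integralD// integralZl//; last exact: integrable_indic.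
rewrite integral_indic// setIT.
apply: (@le_trans _ _ (outer_expectation P Y' + (e / 2)%:E +
    c%:E * (outer_probability P A + (e / 2 / (c + 1))%:E))).
  by apply: leeD; [exact: ltW|apply: lee_pmul => //; exact: ltW].
rewrite -(fineK (outer_expectation_fin_num Y'k)).
rewrite -(fineK (outer_probability_fin_num A)).
rewrite -!(EFinD, EFinM) lee_fin.
have : (c * (e / 2 / (c + 1)) <= e / 2)%R.
  rewrite mulrCA ler_piMr ?(ltW e10)// ler_pdivrMr ?ltr_pwDr//; lra.
lra.
Qed.

End outer.

(** * The metric of [Bloc] and uniform distance on balls *)

Lemma geometric_half_sum (R : realType) (n : nat) :
  \sum_(1 <= k < n) 2^-1 ^+ k <= 1 :> R.
Proof.
case: n => [|n]; first by rewrite big_geq.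
suff -> : \sum_(1 <= k < n.+1) 2^-1 ^+ k = 1 - 2^-1 ^+ n :> R.
  by rewrite gerBl exprn_ge0.
elim: n => [|n ih]; first by rewrite big_geq// expr0 subrr.
by rewrite big_nat_recr//= ih exprS; lra.
Qed.

Section Bloc_metric.
Context (R : realType) (V : normedModType R).
Implicit Types g h : Bloc V.

(** A sum of nonnegative terms dominates each of them; comparison with the geometric series makes
    the sum finite, so [fine] in [rho] loses nothing. *)
Lemma rho_term_le (k : nat) g h :
  ((2^-1 ^+ k.+1)%:E * mine 1 (rho_ k.+1 g h) <= (rho g h)%:E)%E.
Proof.
pose a (i : nat) := ((2^-1 ^+ i)%:E * mine 1 (rho_ i g h))%E.
have a_ge0 i : (0 <= a i)%E.
  rewrite mule_ge0 ?lee_fin ?exprn_ge0// le_min lee01/=.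
  apply: (@le_trans _ _ (`|g 0 - h 0|%:E)%E); first by rewrite lee_fin.
  by apply: ereal_sup_ubound; exists 0 => //=; rewrite normr0.
have a_le i : (a i <= (2^-1 ^+ i)%:E)%E.
  by rewrite -[leRHS]mule1 lee_pmul2l ?lte_fin ?exprn_gt0// ge_min lexx.
rewrite fineK; last first.
  rewrite ge0_fin_numE; last first.
    by apply: nneseries_ge0 => n _ _; exact: (a_ge0 n).
  apply: (@le_lt_trans _ _ 1%E); last exact: ltry.
  apply: lime_le; first by apply: is_cvg_nneseries => n _ _; exact: (a_ge0 n).
  apply: nearW => n; apply: (@le_trans _ _ (\sum_(1 <= i < n) (2^-1 ^+ i)%:E)%E).
    by apply: lee_sum => i _; exact: a_le.
  by rewrite sumEFin lee_fin geometric_half_sum.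
apply: le_trans (nneseries_lim_ge k.+2 _) => [|i _ _]; last exact: (a_ge0 i).
by rewrite big_nat_recr//= leeDr// sume_ge0// => i _; exact: (a_ge0 i).
Qed.

Lemma Bloc_mdist_uniform (K e : R) : 0 < e -> exists2 d : R, 0 < d &
  forall g h, mdist g h < d -> forall t, `|t| <= K -> `|g t - h t| <= e.
Proof.
move=> e0; pose k := Num.truncn K; pose q : R := 2^-1 ^+ k.+1.
have q0 : 0 < q by rewrite exprn_gt0.
have e10 : 0 < Num.min 1 e by rewrite lt_min ltr01.
(* The term of index [k.+1], whose ball contains that of radius [K], has weight [q]; the truncation
   at 1 in [rho] accounts for the minimum. *)
exists (q * Num.min 1 e); first exact: mulr_gt0.
move=> g h gh t tK.
have tk : `|t| <= k.+1%:R by rewrite (le_trans tK)// ltW// truncnS_gt.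
have := rho_term_le k g h; rewrite -/q => /le_lt_trans.
move=> /(_ (q * Num.min 1 e)%:E); rewrite lte_fin => /(_ gh).
rewrite EFinM lte_pmul2l// EFin_min.
apply: contraTT; rewrite -ltNge -leNgt => /ltW te.
rewrite le_min !ge_min lexx/=; apply/orP; right.
apply: (@le_trans _ _ `|g t - h t|%:E); first by rewrite lee_fin.
by apply: ereal_sup_ubound; exists t.
Qed.

End Bloc_metric.

(** * Approximate minimizers and their cluster points *)

Section approx_min.
Context (R : realType) (d1 d2 : nat).
Local Notation V := ('rV[R]_d1 * 'rV[R]_d2)%type.
Local Notation B := (Bloc 'rV[R]_d1 * Bloc V)%type.

(* The slack in the first clause absorbs [beta/alpha] times the oscillation of
   [z.2] without any a priori bound on [z.2]. *)
Definition approx_min (m : nat) (z : B) (x : V) : Prop :=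
  (forall s, z.1 x.1 <= z.1 s + m.+1%:R^-1 * (1 + `|z.2 (s, 0)| + `|z.2 x|)) /\
  (forall t, z.2 x <= z.2 (x.1, t) + m.+1%:R^-1).

Lemma approx_min_le (m n : nat) (z : B) (x : V) :
  (m <= n)%N -> approx_min n z x -> approx_min m z x.
Proof.
move=> mn [h1 h2]; have nm : n.+1%:R^-1 <= m.+1%:R^-1 :> R.
  by rewrite lef_pV2 ?posrE ?ltr0n// ler_nat.
split=> [s|t]; first apply: le_trans (h1 s) _; last apply: le_trans (h2 t) _.
  by rewrite lerD2l ler_wpM2r// !addr_ge0.
by rewrite lerD2l.
Qed.

Definition lex_min (z : B) (x : V) : Prop :=
  unique_min_at z.1 x.1 /\ unique_min_at (fun t => z.2 (x.1, t)) x.2.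

Lemma lex_min_approx (m : nat) (z : B) (x : V) : lex_min z x -> approx_min m z x.
Proof.
case: x => x1 x2; move=> [[h1 _] [h2 _]]; split=> [s|t] /=.
  by rewrite (le_trans (h1 s))// lerDl mulr_ge0// !addr_ge0.
by rewrite (le_trans (h2 t))// lerDl.
Qed.

(** Compactness gives a cluster point [y] of [x]. In the limit [y.1] minimizes [z.1] and [y.2]
    minimizes [z.2 (y.1, .)]; uniqueness identifies first [y.1] with [X.1], and only then [y.2] with
    [X.2]. *)
Lemma lex_min_cluster (z : B) (X : V) (a : nat -> B) (x : nat -> V) (M : R) :
  continuous z.1 -> continuous z.2 -> lex_min z X ->
  sum_dist z (a m) @[m --> \oo] --> 0 ->
  (forall m, `|x m| <= M) -> (forall m, approx_min m (a m) (x m)) ->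
  forall A : set V, nbhs X A -> exists m, A (x m).
Proof.
move=> cu cv [[_ uniq1] [_ uniq2]] za xM axm.
have cball n : compact [set y : 'rV[R]_n | `|y| <= M].
  apply: bounded_closed_compact.
    exists M; split; first exact: num_real.
    by move=> K MK y /= /le_trans; apply; exact: ltW.
  apply: (@closed_comp _ _ (fun y : 'rV[R]_n => `|y|) [set r | r <= M]).
    by move=> y _; exact: norm_continuous.
  exact: closed_le.
have xM1 m : `|(x m).1| <= M.
  by apply: le_trans (xM m); rewrite prod_normE le_max lexx.
have xM2 m : `|(x m).2| <= M.
  by apply: le_trans (xM m); rewrite prod_normE le_max lexx orbT.
have [|y [_ xy]] := compact_setX (cball d1) (cball d2)
  (fmap_proper_filter x (F := \oo) _).
  by apply: (nearW (F := \oo)) => m; split; [exact: xM1|exact: xM2].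
have {}xy N A : nbhs y A -> exists2 m, (N <= m)%N & A (x m).
  move=> /(xy [set x m | m in [set m | (N <= m)%N]] A)[|_ [[m Nm <-] Am]].
    by exists N => // m Nm; exists m.
  by exists m.
pose u := z.1; pose v := z.2.
(* The factor 5 counts errors of size [e]: one for near-minimality, two for replacing [a m] by [z],
   and at most two for continuity at [y]. *)
have key s t (e : R) : 0 < e -> e <= 1 ->
    u y.1 <= u s + 5 * e /\ v y <= v (y.1, t) + 5 * e.
  (* For the max norm, [K] bounds [x m], [(s, 0)] and [((x m).1, t)], the points where [a m] is
     compared with [z]. *)
  move=> e0 e1; pose K := M + `|s| + `|t|.
  have [r1 r10 ur] := Bloc_mdist_uniform 'rV[R]_d1 K e0.
  have [r2 r20 vr] := Bloc_mdist_uniform V K e0.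
  (* With [vm] the second component of [a m], [c] bounds [1 + |vm (s, 0)| + |vm (x m)|]: passing
     from [vm] to [v] twice and from [v (x m)] to [v y] costs at most [3 * e <= 3]. *)
  pose c := 4 + `|v (s, 0)| + `|v y|.
  have c0 : 0 < c by rewrite /c -addrA ltr_pwDl// addr_ge0.
  have ec0 : 0 < e / c by exact: divr_gt0.
  have [N _ NP] : \forall m \near \oo,
      [/\ sum_dist z (a m) < r1, sum_dist z (a m) < r2 & m.+1%:R^-1 < e / c].
    near=> m; split; near: m.
    - by apply: (cvgr_lt 0 za).
    - by apply: (cvgr_lt 0 za).
    - exact: (near_infty_natSinv_lt (PosNum ec0)).
  have cu1 : u p.1 @[p --> y] --> u y.1.
    by apply: continuous_comp; [exact: cvg_fst|exact: cu].
  have cv1 : v (p.1, t) @[p --> y] --> v (y.1, t).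
    apply: (continuous_comp (f := fun p : V => (p.1, t)) (g := v)); last exact: cv.
    apply: (cvg_pair (F := nbhs y) (G := nbhs y.1) (H := nbhs t)).
      exact: cvg_fst.
    exact: cvg_cst.
  have [m Nm [nu [nv nvt]]] := xy N _ (filterI (cvgr_dist_lt _ _ cu1 _ e0)
    (filterI (cvgr_dist_lt _ _ (cv y) _ e0) (cvgr_dist_lt _ _ cv1 _ e0))).
  have [zr1 zr2 mc] := NP m Nm; have [/(_ s) h1 /(_ t) h2] := axm m.
  have {}zr1 : mdist z.1 (a m).1 < r1.
    by apply: le_lt_trans zr1; rewrite lerDl mdist_ge0.
  have {}zr2 : mdist z.2 (a m).2 < r2.
    by apply: le_lt_trans zr2; rewrite lerDr mdist_ge0.
  have M0 : 0 <= M by exact: le_trans (xM m).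
  have K1 (r : R) : r <= M -> r <= K.
    by move=> rM; rewrite (le_trans rM)// /K -addrA lerDl addr_ge0.
  have Ks : `|s| <= K by rewrite /K addrAC lerDr addr_ge0.
  have Kt : `|t| <= K by rewrite /K lerDr addr_ge0.
  have := ur _ _ zr1 _ (K1 _ (xM1 m)); have := ur _ _ zr1 _ Ks.
  have := vr _ _ zr2 _ (K1 _ (xM m)).
  have := vr _ _ zr2 (s, 0); rewrite prod_normE/= normr0 max_l// => /(_ Ks).
  have := vr _ _ zr2 ((x m).1, t); rewrite prod_normE/= ge_max K1//= => /(_ Kt).
  move: nu nv nvt h1 h2; rewrite -/u -/v.
  move: (a m).1 (a m).2 => um vm nu nv nvt h1 h2 vt vs vx us ux.
  pose k : R := m.+1%:R^-1; rewrite -/k in h1 h2 mc.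
  have k0 : 0 <= k by rewrite invr_ge0 ler0n.
  have kc : k * c <= e by rewrite -ler_pdivlMr// ltW.
  have ke : k <= e.
    apply: le_trans kc; rewrite ler_peMr// /c.
    by have := normr_ge0 (v (s, 0)); have := normr_ge0 (v y); lra.
  have {}h1 : um (x m).1 <= um s + e.
    apply: (le_trans h1); rewrite lerD2l; apply: le_trans kc; rewrite ler_wpM2l//.
    have normB (p q : R) : `|q| <= `|p| + `|p - q|.
      by rewrite -{1}(subKr p q) ler_normB.
    have := normB (v (s, 0)) (vm (s, 0)).
    have := normB (v (x m)) (vm (x m)).
    have := normB (v y) (v (x m)).
    rewrite /c; lra.
  move: nu nv nvt vt vs vx us ux; rewrite !ltr_norml !ler_norml.
  by move=> /andP[? ?] /andP[? ?] /andP[? ?] /andP[? ?] /andP[? ?] /andP[? ?]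
    /andP[? ?] /andP[? ?]; split; lra.
have {}key s t : u y.1 <= u s /\ v y <= v (y.1, t).
  suff small e : 0 < e -> u y.1 <= u s + e /\ v y <= v (y.1, t) + e.
    by split; apply/ler_addgt0Pr => e /small[].
  move=> e0; pose e' := Num.min 1 e / 5.
  have m1 : Num.min 1 e <= 1 by rewrite ge_min lexx.
  have me : Num.min 1 e <= e by rewrite ge_min lexx orbT.
  have e'0 : 0 < e' by rewrite divr_gt0// lt_min ltr01.
  have [|] := key s t e' e'0; first by rewrite /e'; lra.
  by rewrite /e' => ? ?; split; lra.
have y1 : y.1 = X.1 by apply: uniq1 => s; have [] := key s 0.
have y2 : y.2 = X.2.
  by apply: uniq2 => t; have [_] := key 0 t; rewrite -y1 -surjective_pairing.
move=> A; rewrite (_ : X = y); first by move=> /(xy 0%N)[m _ Am]; exists m.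
by rewrite (surjective_pairing X) -y1 -y2 -surjective_pairing.
Unshelve. all: by end_near. Qed.
End approx_min.

(** * Eventual bounds and limits of sequences *)

Section limits.
Context (R : realType).

Lemma near_le_cvge (u : nat -> \bar R) (l e : R) :
  u n @[n --> \oo] --> l%:E -> 0 < e -> \forall n \near \oo, (u n <= (l + e)%:E)%E.
Proof.
move=> /fine_cvgP[ufin ul] e0.
have ll : l < l + e by rewrite ltrDl.
apply: filterS2 ufin (cvgr_le _ ul _ ll) => n un /= ule.
by rewrite -(fineK un) lee_fin.
Qed.

Lemma near_le_limn_esup (u : nat -> \bar R) (l l' : R) :
  (limn_esup u <= l%:E)%E -> l < l' -> \forall n \near \oo, (u n <= l'%:E)%E.
Proof.
move=> ul ll'; have : (limn_esup u < l'%:E)%E by rewrite (le_lt_trans ul).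
rewrite /limn_esup /limf_esup => /ereal_inf_lt[_ [A nA <-] Al].
apply: filterS nA => n An; apply: le_trans (ltW Al).
by apply: ereal_sup_ubound; exists n.
Qed.

Lemma not_near_oo (Q : nat -> Prop) : ~ (\forall n \near \oo, Q n) ->
  forall N, exists2 n, (N <= n)%N & ~ Q n.
Proof.
move=> nQ N; apply: contrapT => h; apply: nQ; exists N => // n /= Nn.
by apply: contrapT => Qn; apply: h; exists n.
Qed.

Lemma cvg_le_harmonic (u : nat -> R) (C : R) :
  (forall n, 0 <= u n <= C * n.+1%:R^-1) -> u n @[n --> \oo] --> 0.
Proof.
move=> uC; apply: (@squeeze_cvgr _ _ _ _ (cst 0) (fun n => C * n.+1%:R^-1)).
- exact: nearW.
- exact: cvg_cst.
- by rewrite -[X in _ --> X](mulr0 C); apply: cvgMr; exact: cvg_harmonic.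
Qed.

Lemma cvge_two_sided (u : nat -> \bar R) (l : R) :
  (forall n, u n \is a fin_num) ->
  (forall e, 0 < e -> \forall n \near \oo, ((l - e)%:E <= u n <= (l + e)%:E)%E) ->
  u n @[n --> \oo] --> l%:E.
Proof.
move=> ufin ul; apply/fine_cvgP; split; first exact: nearW.
apply/cvgrPdist_le => e e0; apply: filterS (ul e e0) => n /=.
by rewrite -{1 2}(fineK (ufin n)) !lee_fin ler_norml => /andP[? ?]; lra.
Qed.

End limits.

(** * Expectations of bounded measurable functions *)

Section expectation_bounded.
Local Open Scope ereal_scope.
Context d (T : measurableType d) (R : realType) (P : probability T R).

Lemma measurable_fun_open_preimage (S : topologicalType) (Z : T -> S) (h : S -> R) :
  (forall U, open U -> measurable (Z @^-1` U)) -> continuous h ->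
  measurable_fun setT (h \o Z).
Proof.
move=> mZ /continuousP ch.
apply: (measurability _ (RGenOpens.measurableE R)).
move=> _ [_ [a [b ->] <-]]; rewrite setTI comp_preimage.
by apply/mZ/ch; exact: interval_open.
Qed.

Lemma bounded_integrable (Y : T -> R) (k : R) : measurable_fun setT Y ->
  (forall w, (`|Y w| <= k)%R) -> P.-integrable setT (EFin \o Y).
Proof.
move=> mY Yk; apply: measurable_bounded_integrable => //.
  by rewrite /= probability_setT ltry.
exists k; split; first exact: num_real.
by move=> x kx y _ /=; apply: le_trans (Yk y) _; exact: ltW.
Qed.

Lemma expectation_fin (Y : T -> R) (k : R) : measurable_fun setT Y ->
  (forall w, (`|Y w| <= k)%R) -> 'E_P[Y] \is a fin_num.
Proof.
move=> mY Yk; rewrite unlock; apply: integrable_fin_num => //.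
exact: bounded_integrable Yk.
Qed.

Lemma expectation_opp (Y : T -> R) (k : R) : measurable_fun setT Y ->
  (forall w, (`|Y w| <= k)%R) -> 'E_P[(\- Y)%R] = - 'E_P[Y].
Proof.
move=> mY Yk; rewrite unlock -[RHS]mulN1e -integralZl//.
  by apply: eq_integral => w _; rewrite mulN1e.
exact: bounded_integrable Yk.
Qed.

(* Dominated convergence is applied to the maximum of [Y] and [Y_ n]. *)
Lemma expectation_limsup_le (Y_ : nat -> T -> R) (Y : T -> R) (k e : R) :
  (forall n, measurable_fun setT (Y_ n)) -> measurable_fun setT Y ->
  (forall n w, (`|Y_ n w| <= k)%R) -> (forall w, (`|Y w| <= k)%R) ->
  {ae P, forall w, forall r : R, (0 < r)%R ->
    \forall n \near \oo, (Y_ n w <= Y w + r)%R} ->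
  (0 < e)%R -> exists n, 'E_P[Y_ n] <= 'E_P[Y] + e%:E.
Proof.
move=> mY_ mY Y_k Yk Y_Y e0.
pose X n w := Num.max (Y w) (Y_ n w).
have mX n : measurable_fun setT (X n) by exact: measurable_maxr.
have Xk n w : (`|X n w| <= k)%R by rewrite /X maxEle; case: ifP.
have XY : {ae P, forall w, setT w -> (X n w)%:E @[n --> \oo] --> (Y w)%:E}.
  apply: filterS Y_Y => w Y_Yw _; apply/fine_cvgP; split; first exact: nearW.
  apply/cvgrPdist_le => r r0; apply: filterS (Y_Yw r r0) => n /= Yr.
  rewrite distrC ger0_norm ?subr_ge0 ?le_max ?lexx//.
  by rewrite lerBlDl ge_max Yr andbT lerDl ltW.
have [_ _] := dominated_convergence (mu := P) measurableT
  (fun n => (measurable_EFinP _ _).2 (mX n)) ((measurable_EFinP _ _).2 mY) XY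
  (finite_measure_integrable_cst P k measurableT)
  (aeW P (fun w n _ => Xk n w : (`|(X n w)%:E| <= k%:E)%E)).
have Yfin := expectation_fin mY Yk.
move: Yfin; rewrite unlock => Yfin.
rewrite -(fineK Yfin) => /near_le_cvge/(_ e0)[N _ /(_ N (leqnn N)) XN].
exists N; rewrite -EFinD; apply: le_trans XN; apply: le_integral => //.
- exact: bounded_integrable (Y_k N).
- exact: bounded_integrable (Xk N).
- by move=> w _ /=; rewrite lee_fin /X le_max lexx orbT.
Qed.

End expectation_bounded.

(** * Envelopes and neighbourhoods built from approximate minimizers *)

Section lex_min_functionals.
Context (R : realType) (d1 d2 : nat).
Local Notation V := ('rV[R]_d1 * 'rV[R]_d2)%type.
Local Notation B := (Bloc 'rV[R]_d1 * Bloc V)%type.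

(** Against the competitor [(s, 0)] the [be]-terms cost at most [be * q <= al * (k * q)], the slack
    of the first clause. Against [(s0, t)] the [al]-terms cancel. *)
Lemma near_inf_approx_min (m : nat) (al be : R) (z : B) (H : V -> R)
    (r : \bar R) (x : V) :
  0 < al -> 0 < be -> be <= m.+1%:R^-1 * al ->
  (forall s t, H (s, t) = al * z.1 s + be * z.2 (s, t)) ->
  (`|r| <= (m.+1%:R^-1 * be)%:E)%E ->
  ((H x)%:E - r <= ereal_inf (range (fun y => (H y)%:E)))%E ->
  approx_min m z x.
Proof.
case: x r => s0 t0 [r| |] //= al0 be0 beal HE; rewrite lee_fin => rbe Hinf.
have k0 : 0 <= m.+1%:R^-1 :> R by rewrite invr_ge0 ler0n.
have k1 : m.+1%:R^-1 <= 1 :> R by rewrite invf_le1// ler1n.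
set k := m.+1%:R^-1 in k0 k1 beal rbe *.
have Hle s t : al * z.1 s0 + be * z.2 (s0, t0) <=
    al * z.1 s + be * z.2 (s, t) + k * be.
  have : ((H (s0, t0))%:E - r%:E <= (H (s, t))%:E)%E.
    by apply: le_trans Hinf _; apply: ereal_inf_lbound; exists (s, t).
  rewrite !HE -EFinB lee_fin; move: rbe; rewrite ler_norml => /andP[]; lra.
split=> [s|t] /=; rewrite -/k; last first.
  by rewrite -(ler_pM2l be0); have := Hle s0 t; lra.
rewrite -(ler_pM2l al0) mulrDr; set q := 1 + _ + _.
have q0 : 0 <= q by rewrite !addr_ge0.
have h1 : be * q <= al * (k * q).
  by rewrite mulrA (mulrC al) ler_wpM2r.
have h2 : be * (z.2 (s, 0) - z.2 (s0, t0) + k) <= be * q.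
  rewrite ler_pM2l// /q; have := ler_norm (z.2 (s, 0)).
  by have := ler_norm (- z.2 (s0, t0)); rewrite normrN; lra.
by have := Hle s 0; lra.
Qed.

Definition approx_min_values (h : V -> R) (M : R) (m : nat) : set (R * B) :=
  [set p | exists2 x, `|x| <= M & approx_min m p.2 x /\ p.1 = h x].

Lemma approx_min_seq_cvg (h : V -> R) (M c e : R) (z : B) (X : V) :
  continuous z.1 -> continuous z.2 -> lex_min z X -> {for X, continuous h} ->
  (forall x, `|h x| <= c) -> 0 < e ->
  \forall m \near \oo,
    lip_env m.+1%:R c (approx_min_values h M m) z <= h X + e.
Proof.
move=> cz1 cz2 zX ch hc e0; apply: contrapT => /not_near_oo env_gt.
have c0 : 0 <= c by exact: le_trans (hc X).
(* The penalty [m.+1%:R * sum_dist z a] is below [h x - h X <= 2 * c], whence the distance bound.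
   Only some level [m >= N] is available; both level and bound are weakened to [N]. The resulting
   sequence contradicts [lex_min_cluster]. *)
have /choice[ax axP] : forall N, exists ax : B * V,
    [/\ `|ax.2| <= M, approx_min N ax.1 ax.2, h X + e < h ax.2 &
       sum_dist z ax.1 <= 2 * c * N.+1%:R^-1].
  move=> N; have [m Nm /negP] := env_gt N; rewrite -ltNge => /lip_env_gt.
  case=> //.
  - by move=> [_ a] [x _ [_ /= ->]]; have := hc x; rewrite ler_norml => /andP[].
  - by have := hc X; rewrite ler_norml => /andP[? ?]; lra.
  move=> [_ a] [x xM [/= ax ->]] hx; exists (a, x) => /=.
  have d0 := sum_dist_ge0 z a.
  have m0 : 0 < m.+1%:R :> R by rewrite ltr0n.
  split => //.
  - exact: approx_min_le ax.
  - by apply: lt_le_trans hx _; rewrite lerBlDr lerDl mulr_ge0// ltW.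
  - apply: (@le_trans _ _ (2 * c * m.+1%:R^-1)); last first.
      by rewrite ler_wpM2l ?mulr_ge0// lef_pV2 ?posrE ?ltr0n// ler_nat.
    rewrite ler_pdivlMr// mulrC.
    have := hc X; have := hc x; rewrite !ler_norml => /andP[? ?] /andP[? ?].
    lra.
have axM N : `|(ax N).2| <= M by have [] := axP N.
have [|||N /=] := lex_min_cluster cz1 cz2 zX (a := fun N => (ax N).1) _ axM
  _ (cvgr_lt _ ch (h X + e) _).
- apply: (@cvg_le_harmonic _ _ (2 * c)) => N.
  by rewrite sum_dist_ge0/=; have [] := axP N.
- by move=> N; have [] := axP N.
- by rewrite ltrDl.
by have [_ _ hX _] := axP N; rewrite ltNge (ltW hX).
Qed.

(** A union of balls is open whatever its centres, so its preimage under [Z] is measurable. *)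
Definition approx_min_nbhs (m : nat) (F : set V) (M : R) : set B :=
  \bigcup_(a in [set a | exists2 x, `|x| <= M & approx_min m a x /\ F x])
    [set z | sum_dist z a < m.+1%:R^-1].

Lemma open_approx_min_nbhs m F M : open (approx_min_nbhs m F M).
Proof.
apply: bigcup_open => a _.
have /continuousP ca : continuous (fun z : B => sum_dist z a).
  apply: (@lipschitz_continuous_sum_dist _ _ _ _ 1) => z z'.
  by rewrite mul1r lerBlDr sum_dist_triangle.
exact: (ca _ (@open_lt R m.+1%:R^-1)).
Qed.

(** Forward, [z] is itself a centre. Conversely, centres converging to [z] have approximate
    minimizers in the part of [F] within the ball, and this closed set contains their cluster point
    [X]. *)
Lemma lex_min_in_closed (F : set V) (M : R) (z : B) (X : V) :
  closed F -> continuous z.1 -> continuous z.2 -> lex_min z X ->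
  (F X /\ `|X| <= M) <-> (forall m, approx_min_nbhs m F M z).
Proof.
move=> cF cz1 cz2 zX; split=> [[FX XM] m|zF].
  exists z; last by rewrite /= sum_distxx invr_gt0 ltr0n.
  by exists X => //; split => //; exact: lex_min_approx.
have /choice[ax axP] : forall m, exists ax : B * V,
    [/\ `|ax.2| <= M, approx_min m ax.1 ax.2, F ax.2 &
       sum_dist z ax.1 < m.+1%:R^-1].
  by move=> m; have [a [x xM [ax Fx]] za] := zF m; exists (a, x).
have cG : closed (F `&` [set x | `|x| <= M]).
  apply: closedI => //.
  apply: (@closed_comp _ _ (fun y : V => `|y|) [set r | r <= M]).
    by move=> y _; exact: norm_continuous.
  exact: closed_le.
apply: (cG X) => A XA.
have axM N : `|(ax N).2| <= M by have [] := axP N.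
have [||N AN] := lex_min_cluster cz1 cz2 zX (a := fun N => (ax N).1) _ axM _ XA.
- apply: (@cvg_le_harmonic _ _ 1) => N.
  by rewrite sum_dist_ge0/= mul1r ltW//; have [] := axP N.
- by move=> N; have [] := axP N.
by exists (ax N).2; split => //; split => //; have [] := axP N.
Qed.

End lex_min_functionals.

(** * A Borel version of the limit minimizer *)

Section borel_version.
Context (R : realType) (d1 d2 : nat) (disp : measure_display)
  (Omega : measurableType disp).
Local Notation V := ('rV[R]_d1 * 'rV[R]_d2)%type.
Local Notation B := (Bloc 'rV[R]_d1 * Bloc V)%type.

(** Off [N], membership of [X] in the closed complement of [U] is a countable union over radii [k]
    of countable intersections over levels [m] of open events of [Z]; on [N] the patched map is the
    constant [point]. *)
Lemma measurable_lex_min (Z : Omega -> B) (X : Omega -> V) (N : set Omega) :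
  measurable N -> (forall U, open U -> measurable (Z @^-1` U)) ->
  (forall w, ~ N w ->
    [/\ continuous (Z w).1, continuous (Z w).2 & lex_min (Z w) (X w)]) ->
  forall U, open U -> measurable ((X \_ (~` N)) @^-1` U).
Proof.
move=> mN mZ ZX U oU.
have {oU} cF : closed (~` U) by exact: open_closedC.
have -> : (X \_ (~` N)) @^-1` U =
    ~` ((N `&` [set _ | ~ U point]) `|` (~` N `&` \bigcup_(k in [set: nat])
      \bigcap_(m in [set: nat]) Z @^-1` approx_min_nbhs m (~` U) k%:R)).
  rewrite -[LHS]setCK; congr (~` _); apply/seteqP; split=> w /=.
    rewrite /patch; have [Nw|nNw] := pselect (N w).
      by rewrite memNset => [nU0|/(_ Nw)//]; left.
    rewrite mem_set//= => nUX; right; split => //.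
    have [cz1 cz2 zX] := ZX w nNw.
    exists (Num.truncn `|X w|).+1 => // m _ /=.
    apply: (lex_min_in_closed _ cF cz1 cz2 zX).1; split => //.
    by rewrite ltW// truncnS_gt.
  rewrite /patch => -[[Nw nU0]|[nNw [k _ km]]].
    by rewrite memNset// => /(_ Nw).
  have [cz1 cz2 zX] := ZX w nNw; rewrite mem_set//.
  by have [] := (lex_min_in_closed k%:R cF cz1 cz2 zX).2 (fun m => km m I).
apply: measurableC; apply: measurableU.
  apply: measurableI => //; have [U0|U0] := pselect (U point).
    by rewrite (_ : [set _ | _] = set0)//; apply/seteqP; split.
  by rewrite (_ : [set _ | _] = setT)//; apply/seteqP; split.
apply: measurableI; first exact: measurableC.
apply: bigcupT_measurable => k; apply: bigcapT_measurable => m.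
exact/mZ/open_approx_min_nbhs.
Qed.

End borel_version.

(** * Convergence in distribution of approximate minimizers *)

Section approx_min_convergence.
Context (R : realType) (d1 d2 : nat)
  (disp_ : nat -> measure_display) (Omega_ : forall n, measurableType (disp_ n))
  (P_ : forall n, probability (Omega_ n) R)
  (disp : measure_display) (Omega : measurableType disp) (P : probability Omega R).
Local Notation V := ('rV[R]_d1 * 'rV[R]_d2)%type.
Local Notation B := (Bloc 'rV[R]_d1 * Bloc V)%type.
Context (z_ : forall n, Omega_ n -> B) (x_ : forall n, Omega_ n -> V)
  (Z : Omega -> B) (X : Omega -> V).
Arguments z_ : clear implicits.
Arguments x_ : clear implicits.
Hypotheses (mZ : forall U, open U -> measurable (Z @^-1` U))
  (mX : forall U, open U -> measurable (X @^-1` U))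
  (ZX : {ae P, forall w,
     [/\ continuous (Z w).1, continuous (Z w).2 & lex_min (Z w) (X w)]})
  (z_Z : forall h : B -> R, continuous h -> [bounded h z | z in setT] ->
     outer_expectation (P_ n) (h \o z_ n) @[n --> \oo] --> 'E_P[h \o Z]%E)
  (x_tight : bigO_pstar P_ (fun n w => `|x_ n w|%:E))
  (x_min : forall m (e : R), 0 < e -> \forall n \near \oo,
     (outer_probability (P_ n) [set w | ~ approx_min m (z_ n w) (x_ n w)]
        <= e%:E)%E).

Lemma approx_min_limsup (h : V -> R) (c e : R) :
  continuous h -> (forall x, `|h x| <= c) -> 0 < e ->
  \forall n \near \oo,
    (outer_expectation (P_ n) (h \o x_ n) <= 'E_P[h \o X] + e%:E)%E.
Proof.
move=> ch hc e0; have c0 : 0 <= c by exact: le_trans (hc 0).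
(* Error budget: [e / 4] for the envelope in the limit, [e / 4] for the convergence of [z_], and
   [3 * (e / 8)] for a bad event of outer probability at most [3 * eta], on which the gap is at most
   [2 * c]. *)
pose eta := e / 8 / (2 * c + 1).
have eta0 : 0 < eta by rewrite !divr_gt0// ltr_pwDr// mulr_ge0.
have eta3 : 2 * c * (2 * eta + eta) <= 3 * (e / 8).
  have -> : e / 8 = eta * (2 * c + 1).
    by rewrite /eta divfK// gt_eqF// ltr_pwDr// mulr_ge0.
  by nra.
have [M xM] := x_tight eta0.
pose env m : B -> R := lip_env m.+1%:R c (approx_min_values h M m).
have m0 m : 0 <= m.+1%:R :> R by rewrite ler0n.
have valc m p : approx_min_values h M m p -> p.1 <= c.
  by move=> [x _ [_ ->]]; rewrite (le_trans (ler_norm _)).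
have envc m z : `|env m z| <= c.
  by rewrite ler_norml lip_env_ge//= ?lip_env_le//; exact: valc.
have cenv m : continuous (env m) by apply: lip_env_continuous => //; exact: valc.
have menv m : measurable_fun setT (env m \o Z).
  exact: measurable_fun_open_preimage.
have mhX : measurable_fun setT (h \o X) by exact: measurable_fun_open_preimage.
have e40 : 0 < e / 4 by exact: divr_gt0.
(* The level [m] is fixed from the limit alone, before [n], so [z_Z] is applied to a single
   continuous function. *)
have [m Em] : exists m, ('E_P[env m \o Z] <= 'E_P[h \o X] + (e / 4)%:E)%E.
  apply: (expectation_limsup_le (k := c)) => // [m w|w|].
  - exact: envc.
  - exact: hc.
  apply: filterS ZX => w [cz1 cz2 zX] r r0.
  by apply: approx_min_seq_cvg => //; exact: ch.
have benv : [bounded env m z | z in setT].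
  exists c; split; first exact: num_real.
  by move=> y cy z _; apply: le_trans (envc m z) _; exact: ltW.
have := z_Z (cenv m) benv.
have fE := expectation_fin P (menv m) (fun w => envc m (Z w)).
have fX := expectation_fin P mhX (fun w => hc (X w)).
rewrite -(fineK fE) => /near_le_cvge/(_ e40) nearE.
have eta2 : eta < 2 * eta by lra.
have nearM := near_le_limn_esup xM eta2.
apply: filterS3 nearE nearM (x_min m eta0) => n nE nM nA.
pose bad := [set w | (M%:E < `| `|x_ n w|%:E|)%E] `|`
  [set w | ~ approx_min m (z_ n w) (x_ n w)].
(* Off [bad], the pair [(h (x_ n w), z_ n w)] enters the envelope at [z_ n w] with zero penalty. *)
have h_le : (outer_expectation (P_ n) (h \o x_ n) <=
    outer_expectation (P_ n) (env m \o z_ n) +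
    (2 * c)%:E * outer_probability (P_ n) bad)%E.
  apply: (@outer_expectation_le_add _ _ _ _ bad _ _ (2 * c) c) => [|w|w|w nbad].
  - exact: mulr_ge0.
  - exact: envc.
  - have := envc m (z_ n w); have := hc (x_ n w); rewrite !ler_norml /=.
    by move=> /andP[? ?] /andP[? ?]; lra.
  - have xwM : `|x_ n w| <= M.
      by rewrite leNgt; apply/negP => Mx; apply: nbad; left; rewrite /= normr_id.
    have aw : approx_min m (z_ n w) (x_ n w).
      by apply: contrapT => na; apply: nbad; right.
    have := lip_env_ub (m0 m) c0 (valc m) (z_ n w) (p := (h (x_ n w), z_ n w)).
    by rewrite /= sum_distxx mulr0 subr0; apply; exists (x_ n w).
apply: (le_trans h_le); have := outer_probabilityU (P_ n)
  [set w | (M%:E < `| `|x_ n w|%:E|)%E] [set w | ~ approx_min m (z_ n w) (x_ n w)].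
rewrite -/bad => badU.
have {nM nA badU} nbad : (outer_probability (P_ n) bad <= (2 * eta + eta)%:E)%E.
  by apply: (le_trans badU); rewrite EFinD leeD.
have : ((2 * c)%:E * outer_probability (P_ n) bad <= (3 * (e / 8))%:E)%E.
  apply: (@le_trans _ _ ((2 * c)%:E * (2 * eta + eta)%:E)%E).
    by rewrite lee_wpmul2l// lee_fin mulr_ge0.
  by rewrite -EFinM lee_fin.
move=> hbad; apply: (le_trans (leeD nE hbad)).
move: Em; rewrite -(fineK fE) -(fineK fX) -!EFinD !lee_fin; lra.
Qed.

Lemma approx_min_cvg (h : V -> R) :
  continuous h -> [bounded h x | x in setT] ->
  outer_expectation (P_ n) (h \o x_ n) @[n --> \oo] --> 'E_P[h \o X]%E.
Proof.
(* Boundedness provides a bound by every number above [c], hence [c + 1]. *)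
move=> ch [c [_ hc']]; pose k := c + 1.
have hk x : `|h x| <= k by apply: hc' => //; rewrite ltrDl.
have Nhk x : `|(\- h) x| <= k by rewrite normrN.
have mhX : measurable_fun setT (h \o X) by exact: measurable_fun_open_preimage.
have fX := expectation_fin P mhX (fun w => hk (X w)).
rewrite -(fineK fX); apply: cvge_two_sided => [n|e e0].
  by apply: (@outer_expectation_fin_num _ _ _ _ _ k) => w; exact: hk.
have cNh : continuous (\- h) by move=> x; apply: cvgN; exact: ch.
apply: filterS2 (approx_min_limsup ch hk e0) (approx_min_limsup cNh Nhk e0).
move=> n hle; rewrite !EFinD fineK// hle andbT.
rewrite [X in (_ <= X + _)%E](expectation_opp P mhX (fun w => hk (X w))) => Nhle.
have := outer_expectation_opp_le (P_ n) (fun w => hk (x_ n w)).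
apply: le_trans; rewrite leeNr (le_trans Nhle)//.
by rewrite -(fineK fX) -EFinN -!EFinD -EFinN lee_fin; lra.
Qed.

End approx_min_convergence.

Theorem theorem1 (R : realType) (d1 d2 : nat)
  (disp_ : nat -> measure_display) (Omega_ : forall n, measurableType (disp_ n))
  (P_ : forall n, probability (Omega_ n) R)
  (disp : measure_display) (Omega : measurableType disp) (P : probability Omega R)
  (H_ : forall n, Omega_ n -> 'rV[R]_d1 * 'rV[R]_d2 -> R)
  (f_ : forall n, Omega_ n -> Bloc 'rV[R]_d1)
  (g_ : forall n, Omega_ n -> Bloc ('rV[R]_d1 * 'rV[R]_d2)%type)
  (s_ : forall n, Omega_ n -> 'rV[R]_d1) (t_ : forall n, Omega_ n -> 'rV[R]_d2)
  (alpha beta : nat -> R)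
  (f : Omega -> Bloc 'rV[R]_d1)
  (g : Omega -> Bloc ('rV[R]_d1 * 'rV[R]_d2)%type)
  (sstar : Omega -> 'rV[R]_d1) (tstar : Omega -> 'rV[R]_d2)
  (H_decomp : forall n w s t,
     H_ n w (s, t) = alpha n * f_ n w s + beta n * g_ n w (s, t))
  (alpha_gt0 : forall n, 0 < alpha n)
  (beta_gt0 : forall n, 0 < beta n)
  (beta_alpha : beta =o_\oo alpha)
  (fg_cvg : cvg_in_distribution P_ P
     (fun n w => (f_ n w, g_ n w)) (fun w => (f w, g w)))
  (fg_cont : {ae P, forall w, continuous (f w) /\ continuous (g w)})
  (near_min : exists r_ : forall n, Omega_ n -> \bar R,
     littleo_pstar P_ r_ beta /\
     forall n w, ((H_ n w (s_ n w, t_ n w))%:E - r_ n w <=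
       ereal_inf (range (fun st => (H_ n w st)%:E)))%E)
  (tight : bigO_pstar P_ (fun n w => `|(s_ n w, t_ n w)|%:E))
  (sstar_min : {ae P, forall w, unique_min_at (f w) (sstar w)})
  (tstar_min : {ae P, forall w,
     unique_min_at (fun t => g w (sstar w, t)) (tstar w)}) :
  cvg_in_distribution P_ P
    (fun n w => (s_ n w, t_ n w)) (fun w => (sstar w, tstar w)).

Proof.
case: fg_cvg => Z [mZ Z_fg z_Z]; case: near_min => r [r_small Hinf].
have ZX : {ae P, forall w, [/\ continuous (Z w).1, continuous (Z w).2 &
    lex_min (Z w) (sstar w, tstar w)]}.
  near=> w; have -> : Z w = (f w, g w) by near: w.
  have [cf cg] : continuous (f w) /\ continuous (g w) by near: w.
  by split => //; split => /=; near: w.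
have [N [mN PN0 subN]] := ZX.
have ZXN w : ~ N w -> [/\ continuous (Z w).1, continuous (Z w).2 &
    lex_min (Z w) (sstar w, tstar w)].
  by move=> nNw; apply: contrapT => nZX; apply/nNw/subN.
(* The version required by the conclusion: [(sstar, tstar)] off the measurable null set [N], and
   [point] on it. *)
pose X := (fun w => (sstar w, tstar w)) \_ (~` N).
have XE w : ~ N w -> X w = (sstar w, tstar w).
  by move=> nNw; rewrite /X /patch mem_set.
have mX : forall U, open U -> measurable (X @^-1` U).
  exact: measurable_lex_min ZXN.
exists X; split => //.
  exists N; split => // w /= nXw; apply: contrapT => /XE; exact: nXw.
move=> h ch bh.
apply: (@approx_min_cvg _ _ _ _ _ P_ _ _ P (fun n w => (f_ n w, g_ n w))
  (fun n w => (s_ n w, t_ n w)) Z X) => //.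
  exists N; split => // w /= nZX; apply: contrapT => nNw.
  by apply: nZX; rewrite XE//; exact: ZXN.
move=> m e e0.
have m0 : 0 < m.+1%:R^-1 :> R by rewrite invr_gt0 ltr0n.
(* Both small-order hypotheses are used at the ratio [m.+1%:R^-1], as [near_inf_approx_min]
   demands. *)
have nP := near_le_cvge (r_small _ m0) e0.
have nba := (eqoP _ _ _).1 beta_alpha _ m0.
apply: filterS2 nP nba => n nP nba.
(* Failure of [approx_min] at level [m] forces [r n w] to be large, so its outer probability tends
   to 0. *)
rewrite add0r in nP; apply: le_trans nP; apply: le_outer_probability => w /= nap.
rewrite ltNge; apply/negP => rle; apply: nap.
apply: (@near_inf_approx_min _ _ _ m (alpha n) (beta n) (f_ n w, g_ n w) (H_ n w)
  (r n w) (s_ n w, t_ n w)) => [//|//||s t|//|].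
- by move: nba; rewrite !gtr0_norm.
- exact: H_decomp.
- exact: Hinf.
Unshelve. all: by end_near. Qed.
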